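(* Let $c>0$. Let $X_1,X_2,\ldots$ be independent copies of a non-negative random variable $X$, let $\theta_1,\theta_2,\ldots$ be independent copies of a non-negative random variable $\theta$ with $\mathbb{P}(\theta=0)<1$, where $X$ and $\theta$ are independent, and suppose the sequences $\{X_1,X_2,\ldots\}$ and $\{\theta_1,\theta_2,\ldots\}$ are mutually independent. For $u\geqslant 0$ let $$W(t)=u+ct-\sum_{i=1}^{\Theta(t)}X_i,\quad t\geqslant 0,$$ where $\Theta(t)=\#\{n\geqslant 1: \theta_1+\ldots+\theta_n\in[0,t]\}$, be the surplus process of the E. Sparre Andersen model, and let $\psi(u)$ be its ultimate time ruin probability. If $\mathbb{E}X$ and $\mathbb{E}\theta$ are finite, $\mathbb{E}X/\mathbb{E}\theta=c$ and $\mathbb{P}(X=c\theta)<1$, then $\psi(u)=1$ for all $u\geqslant 0$.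
   Context: For initial surplus $u\geqslant 0$ the time of ruin is $\tau_u=\inf\{t\geqslant 0: W(t)<0\}$, with $\tau_u=\infty$ if $W(t)\geqslant 0$ for all $t\geqslant 0$. The ultimate time ruin probability is $$\psi(u)=\mathbb{P}(\tau_u<\infty)=\mathbb{P}\left(\sup_{n\geqslant 1}\sum_{k=1}^n (X_k-c\,\theta_k)>u\right).$$ *)

(* Defs.v *)
From HB Require Import structures.
From mathcomp Require Export all_boot all_order all_algebra.
From mathcomp Require Export all_classical all_reals all_analysis.

Set Implicit Arguments.
Unset Strict Implicit.
Unset Printing Implicit Defensive.

Import Order.TTheory GRing.Theory Num.Theory.
Import numFieldNormedType.Exports.

Local Open Scope classical_set_scope.
Local Open Scope ring_scope.

Section independence.
Context (d : measure_display) (T : measurableType d) (R : realType).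
Variable P : probability T R.

Definition sigma_of (X : {RV P >-> R}) : set (set T) :=
  preimage_set_system setT X measurable.

Definition sigma_of_seq (X_ : nat -> {RV P >-> R}) : set (set T) :=
  <<s \bigcup_n sigma_of (X_ n) >>.

Definition independent_systems (F G : set (set T)) : Prop :=
  forall A B, F A -> G B -> P (A `&` B) = (P A * P B)%E.

Definition mutually_independent (X_ : nat -> {RV P >-> R}) : Prop :=
  forall (s : seq nat) (A : nat -> set T), uniq s ->
    (forall i, i \in s -> sigma_of (X_ i) (A i)) ->
    P (\bigcap_(i in [set` s]) A i) = (\prod_(i <- s) P (A i))%E.

Definition same_distribution (X Y : {RV P >-> R}) : Prop :=
  forall A, measurable A -> distribution P X A = distribution P Y A.

Definition independent_copies (X_ : nat -> {RV P >-> R}) (X : {RV P >-> R}) :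
    Prop :=
  mutually_independent X_ /\ forall n, same_distribution (X_ n) X.

End independence.

(* Sequences are indexed from 0: [X_ k] and [theta_ k] are the size of the
   claim number [k.+1] and the inter-occurrence time preceding it. *)
Section sparre_andersen.
Context (d : measure_display) (T : measurableType d) (R : realType).
Variables (P : probability T R) (c u : R) (X_ theta_ : nat -> {RV P >-> R}).

(* Extended-valued, since the occurrence times may accumulate on a null set. *)
Definition claim_count (t : R) (w : T) : \bar R :=
  counting [set n | (1 <= n)%N /\ 0 <= \sum_(k < n) theta_ k w <= t].

(* The sum of the first [claim_count t w] claims; it is an infinite series,
   and the surplus may be -oo, when [claim_count t w] is +oo. *)
Definition surplus (t : R) (w : T) : \bar R :=
  ((u + c * t)%:E -
   \sum_(0 <= k <oo | ((k.+1)%:R%:E <= claim_count t w)) (X_ k w)%:E)%E.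

Definition ruin_time (w : T) : \bar R :=
  ereal_inf [set t%:E | t in [set t : R | 0 <= t /\ (surplus t w < 0)%E]].

Definition ruin_probability : \bar R :=
  P [set w | (ruin_time w < +oo)%E].

End sparre_andersen.

(* Main.v *)
From HB Require Import structures.
Require Import Defs.
From mathcomp Require Import measurable_realfun lra.

Set Implicit Arguments.
Unset Strict Implicit.
Unset Printing Implicit Defensive.

Import Order.TTheory GRing.Theory Num.Theory.
Import numFieldNormedType.Exports.

Local Open Scope classical_set_scope.
Local Open Scope ring_scope.
Local Open Scope card_scope.

(** Let [z_k = X_k - c theta_k] and let [M] be the supremum over [n >= 0] of
    the partial sums of the [z_k].  Ruin from [u] happens exactly when some
    partial sum exceeds [u] ([ruin_walkE]: it suffices to look at the claim
    instants), so it is enough to show that [M = +oo] almost surely.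

    No law of large numbers, stopping time or zero-one law enters the argument.
    If [M'] is the same supremum for the sequence shifted by one, then
    [M = max(0, z_0 + M')], where [M'] is independent of [z_0] and has the law
    of [M] ([iid_shift]).  Such an identity is incompatible with a centered,
    nondegenerate [z_0] unless [M] is infinite ([lindley_improper]):

    - On [A = {M' < +oo} = {M < +oo}] the difference [D = M - M'] satisfies
      [z_0 <= D] and [|D| <= |z_0|].  As [M] and [M'] have the same law,
      [min(M, K) - min(M', K)] has integral [0] over [A] for every [K], hence by
      dominated convergence [D] has integral [0] over [A], although [M] itself
      need not be integrable ([integral_diff_same_law]).
    - By independence [z_0] has integral [P(A) E z_0 = 0] over [A]
      ([integral_indep]).  So [D = z_0] a.s. on [A]: the maximum with [0] is
      never active, and [M = z_0 + M'] a.s. on [A].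
    - Choose [a > 0] with [P(z_0 <= -a) > 0].  If [P(M < k a) = 0], then
      [z_0 <= -a] and [M' < (k+1) a] would force [M < k a], so by independence
      [P(z_0 <= -a) P(M < (k+1) a) = 0], that is [P(M < (k+1) a) = 0].
      Induction on [k] gives [P(M < +oo) = 0].

    The independence of [z_0] and [M'] and the equality of the laws of [M] and
    [M'] are one product formula on the space of sequences of pairs
    [(X_k, theta_k)]; it extends from finite cylinders to the generated
    sigma-algebra by Dynkin's argument ([product_rule_dynkin]). *)

(** * Laws and integrals *)

Section preimages.
Context (d d' : measure_display) (T : measurableType d) (E : measurableType d').

Lemma measurable_preimage (f : T -> E) (C : set E) :
  measurable_fun setT f -> measurable C -> measurable (f @^-1` C).
Proof. by move=> mf mC; rewrite -(setTI (_ @^-1` _)); exact: mf. Qed.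

End preimages.

Lemma superlevelE (T : Type) (R : realType) (f : T -> R) (r : R) :
  [set w | (r < f w)%R] = f @^-1` `]r, +oo[.
Proof. by apply/seteqP; split => w /=; rewrite in_itv/= andbT. Qed.

Section integrals.
Context (d : measure_display) (T : measurableType d) (R : realType).
Variable P : probability T R.

(** The integral of a nonnegative function is the integral of its tail. With
    [p = 1] this compares functions with the same law; with [p = P A] it
    compares [f * \1_A] and [f] when [f] and [A] are independent. *)
Lemma ge0_integral_tail_scale (f g : T -> R) (p : \bar R) :
  measurable_fun setT f -> measurable_fun setT g ->
  (forall w, 0 <= f w) -> (forall w, 0 <= g w) -> (0 <= p)%E ->
  (forall r, 0 <= r ->
    P [set w | (r < f w)%R] = (p * P [set w | (r < g w)%R])%E) ->
  (\int[P]_w (f w)%:E = p * \int[P]_w (g w)%:E)%E.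
Proof.
move=> mf mg f0 g0 p0 fg.
pose F : {RV P >-> R} := HB.pack f (isMeasurableFun.Build _ _ _ _ _ mf).
pose G : {RV P >-> R} := HB.pack g (isMeasurableFun.Build _ _ _ _ _ mg).
have := @ge0_expectation_ccdf _ _ _ P F f0; rewrite unlock /= => ->.
have := @ge0_expectation_ccdf _ _ _ P G g0; rewrite unlock /= => ->.
rewrite -ge0_integralZl//; last first.
  by apply: measurable_funS (ccdf_measurable G).
apply: eq_integral => r; rewrite inE/= in_itv/= andbT => r0.
have E (h : {RV P >-> R}) : ccdf h r = P [set w | (r < h w)%R].
  by rewrite superlevelE.
by rewrite !E fg.
Qed.

Lemma integrable_measurable (f : T -> R) :
  P.-integrable setT (EFin \o f) -> measurable_fun setT f.
Proof. by move=> /measurable_int/measurable_EFinP. Qed.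

Lemma integrable_mul_indic (f : T -> R) (A : set T) :
  measurable A -> P.-integrable setT (EFin \o f) ->
  P.-integrable setT (EFin \o (fun w => f w * \1_A w)).
Proof.
move=> mA intf; have mf := integrable_measurable intf.
have m1 : measurable_fun setT (\1_A : T -> R) by [].
apply: le_integrable intf => //.
  by apply/measurable_EFinP; exact: measurable_funM.
move=> w _ /=; rewrite lee_fin normrM ler_piMr// indicE.
by case: (w \in A); rewrite ?normr1 ?normr0.
Qed.

Lemma integral_indep (z : T -> R) (A : set T) :
  P.-integrable setT (EFin \o z) -> measurable A ->
  (forall D : set R, measurable D ->
     P (z @^-1` D `&` A) = P (z @^-1` D) * P A)%E ->
  (\int[P]_w (z w * \1_A w)%:E = P A * \int[P]_w (z w)%:E)%E.
Proof.
move=> iz mA indep; have mz := integrable_measurable iz.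
have i1 : measurable_fun setT (\1_A : T -> R) by [].
pose pos (x : R) := Num.max x 0; pose neg (x : R) := Num.max (- x) 0.
have ipos : P.-integrable setT (EFin \o (pos \o z)).
  exact: integrable_funrpos measurableT iz.
have ineg : P.-integrable setT (EFin \o (neg \o z)).
  exact: integrable_funrneg measurableT iz.
have nonneg (h : R -> R) : measurable_fun setT h -> (forall x, 0 <= h x) ->
    (\int[P]_w (h (z w) * \1_A w)%:E = P A * \int[P]_w (h (z w))%:E)%E.
  move=> mh h0; apply: ge0_integral_tail_scale => //.
  - by apply: measurable_funM => //; exact: measurableT_comp.
  - exact: measurableT_comp.
  - by move=> w; rewrite mulr_ge0.
  move=> r r0.
  have -> : [set w | r < h (z w) * \1_A w] =
      z @^-1` (h @^-1` `]r, +oo[) `&` A.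
    apply/seteqP; split => w /=; rewrite in_itv/= andbT indicE.
      have [wA|wA] := boolP (w \in A); rewrite ?mulr1 ?mulr0 ?ltNge ?r0//.
      by rewrite inE in wA.
    by move=> [? wA]; rewrite mem_set// mulr1.
  rewrite indep; last exact: measurable_preimage.
  by rewrite muleC (superlevelE (h \o z)).
have mpos : measurable_fun setT pos by exact: measurable_funrpos.
have mneg : measurable_fun setT neg by exact: measurable_funrneg.
have zE w : z w = pos (z w) - neg (z w).
  by rewrite /pos /neg; case: (leP (z w) 0); case: (leP (- z w) 0); lra.
transitivity
    (\int[P]_w ((pos (z w) * \1_A w)%:E - (neg (z w) * \1_A w)%:E))%E.
  by apply: eq_integral => w _; rewrite -EFinB -mulrBl -zE.
transitivity (P A * \int[P]_w ((pos (z w))%:E - (neg (z w))%:E))%E; last first.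
  by congr (_ * _)%E; apply: eq_integral => w _; rewrite -EFinB -zE.
rewrite integralB_EFin//; [|exact: (integrable_mul_indic mA ipos)
                           |exact: (integrable_mul_indic mA ineg)].
rewrite integralB_EFin// !nonneg//.
- by rewrite [RHS]muleBr ?fin_num_measure// fin_num_adde_defr//
    (integrable_fin_num _ ipos).
- by move=> x; rewrite le_max lexx orbT.
- by move=> x; rewrite le_max lexx orbT.
Qed.

(** The functions [f] and [g] need not be integrable, so the integral of
    [f - g] cannot be split; truncating both at level [K] gives integrable
    functions whose difference is still dominated by [f - g]. *)
Lemma integral_diff_same_law (f g b : T -> R) :
  measurable_fun setT f -> measurable_fun setT g ->
  (forall w, 0 <= f w) -> (forall w, 0 <= g w) ->
  (forall r, P [set w | (r < f w)%R] = P [set w | (r < g w)%R]) ->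
  P.-integrable setT (EFin \o b) -> (forall w, `|f w - g w| <= `|b w|) ->
  P.-integrable setT (EFin \o (fun w => f w - g w)) /\
  (\int[P]_w (f w - g w)%:E = 0)%E.
Proof.
move=> mf mg f0 g0 fg ib bnd.
pose trunc (h : T -> R) (K : nat) w := Num.min (h w) K%:R.
have trunc_ge0 (h : T -> R) K : (forall w, 0 <= h w) -> forall w, 0 <= trunc h K w.
  by move=> h0 w; rewrite le_min h0 ler0n.
have mtrunc (h : T -> R) K : measurable_fun setT h -> measurable_fun setT (trunc h K).
  by move=> mh; exact: measurable_minr.
have itrunc (h : T -> R) K : measurable_fun setT h -> (forall w, 0 <= h w) ->
    P.-integrable setT (EFin \o trunc h K).
  move=> mh h0.
  apply: (@le_integrable _ _ _ P setT measurableT _ (EFin \o cst K%:R)).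
  - by apply/measurable_EFinP; exact: mtrunc.
  - move=> w _ /=; rewrite lee_fin !ger0_norm ?trunc_ge0//.
    by rewrite ge_min lexx orbT.
  - exact: finite_measure_integrable_cst.
have int0 K : (\int[P]_w (trunc f K w - trunc g K w)%:E = 0)%E.
  under eq_integral do rewrite EFinB.
  rewrite integralB_EFin//; [|exact: itrunc|exact: itrunc].
  rewrite (@ge0_integral_tail_scale (trunc f K) (trunc g K) 1%E)//.
  - by rewrite mul1e subee// (integrable_fin_num measurableT (itrunc g K _ _)).
  - exact: mtrunc.
  - exact: mtrunc.
  - exact: trunc_ge0.
  - exact: trunc_ge0.
  move=> r _; rewrite mul1e.
  have tail (h : T -> R) : [set w | (r < trunc h K w)%R] =
      if r < K%:R then [set w | (r < h w)%R] else set0.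
    case: ifP => rK; apply/seteqP; split => w //=; rewrite lt_min rK ?andbT//.
    by rewrite andbF.
  by rewrite !tail; case: ifP.
pose D K w := trunc f K w - trunc g K w.
have [iD _ cvgD] : [/\ P.-integrable setT (EFin \o (fun w => f w - g w)%R),
   [sequence \int[P]_w `|(D n w)%:E - (f w - g w)%R%:E|]_n @ \oo --> 0%E &
   [sequence \int[P]_w (D n w)%:E]_n @ \oo -->
     (\int[P]_w (f w - g w)%R%:E)]%E.
  apply: (@dominated_convergence _ T R P setT measurableT
    (fun n w => (D n w)%:E) _ (abse \o (EFin \o b))) => //.
  - move=> n; apply/measurable_EFinP; apply: measurable_funB; exact: mtrunc.
  - by apply/measurable_EFinP; exact: measurable_funB.
  - apply: aeW => w _; apply: cvg_near_cst.
    near=> n; congr (_%:E).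
    have fn : f w <= n%:R by near: n; exact: nbhs_infty_ger.
    have gn : g w <= n%:R by near: n; exact: nbhs_infty_ger.
    by rewrite /D /trunc !min_l.
  - exact: integrable_abse.
  - apply: aeW => w n _ /=; rewrite lee_fin /D /trunc.
    apply: le_trans (bnd w); have := ler_norm (f w - g w).
    have := ler_norm (- (f w - g w)); rewrite normrN ler_norml.
    by case: (leP (f w) n%:R); case: (leP (g w) n%:R) => ? ? ? ?;
      apply/andP; split; lra.
split=> //; move: cvgD; rewrite (_ : [sequence _]_n = cst 0%E).
  by move=> /(cvg_lim (@ereal_hausdorff R)); rewrite lim_cst.
exact/funext.
Unshelve. all: by end_near. Qed.

Lemma negative_tail (z : T -> R) : measurable_fun setT z ->
  (P [set w | (z w < 0)%R] != 0)%E ->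
  exists2 a : R, 0 < a & P (z @^-1` `]-oo, (- a)%R]) != 0%E.
Proof.
move=> mz zneg; apply: contrapT => noa; move/eqP: zneg; apply.
have z0 (n : nat) : P (z @^-1` `]-oo, - n.+1%:R^-1]) = 0%E.
  by apply/eqP; apply: contrapT => nz; apply: noa; exists n.+1%:R^-1;
    [rewrite invr_gt0|exact/negP].
have E : [set w | (z w < 0)%R] = \bigcup_n (z @^-1` `]-oo, - n.+1%:R^-1]).
  apply/seteqP; split => w /=.
    rewrite -oppr_gt0 => /ltr_add_invr[k]; rewrite add0r => h; exists k => //=.
    by rewrite in_itv/= lerNr ltW.
  move=> [k _ /=]; rewrite in_itv/= => h.
  by apply: (le_lt_trans h); rewrite oppr_lt0 invr_gt0.
have mE k : measurable (z @^-1` `]-oo, - k.+1%:R^-1]).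
  exact: measurable_preimage.
apply/negligibleP; first by rewrite E; exact: bigcupT_measurable.
by rewrite E; apply: negligible_bigcup => k; exact/negligibleP/z0.
Qed.

Lemma centered_negative (z : T -> R) :
  P.-integrable setT (EFin \o z) -> (\int[P]_w (z w)%:E = 0)%E ->
  (P [set w | z w = 0%R] < 1)%E -> (P [set w | (z w < 0)%R] != 0)%E.
Proof.
move=> iz Ez nz; apply/negP => /eqP neg0.
have mz := integrable_measurable iz.
have mz0 : measurable [set w | z w = 0].
  exact: (measurable_preimage mz (measurable_set1 0)).
have mneg : measurable [set w | (z w < 0)%R].
  have := measurable_preimage mz (measurable_itv `]-oo, 0[).
  by congr measurable; apply/seteqP; split => w /=; rewrite in_itv.
have absz : (\int[P]_w `|(z w)%:E| = \int[P]_w (z w)%:E)%E.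
  apply: ae_eq_integral => //.
  - exact/measurableT_comp/measurable_EFinP.
  - exact/measurable_EFinP.
  exists [set w | (z w < 0)%R]; split => // w /= /not_implyP[_ ne].
  by rewrite ltNge; apply/negP => z0; apply: ne; rewrite /= ger0_norm.
have /ae_eq_integral_abs : (\int[P]_w `|(z w)%:E| = 0)%E by rewrite absz.
move=> /(_ measurableT (measurable_int _ iz)) [N [mN N0 subN]].
have C0 : P (~` [set w | z w = 0%R]) = 0%E.
  apply: (subset_measure0 _ _ _ N0) => //; first exact: measurableC.
  by move=> w /= zw; apply: subN => /= /(_ I) [].
move: nz; rewrite -(setCK [set w | z w = 0%R]) probability_setC.
  by rewrite C0 sube0 ltxx.
exact: measurableC.
Qed.

End integrals.

(** * The recursion for the supremum of a random walk *)

Section lindley.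
Context (d : measure_display) (T : measurableType d) (R : realType).
Variable P : probability T R.

(** The recursion [M = max(0, z + M')] with [M'] a copy of [M] independent of
    the increment [z] is the equation of a stationary waiting time; for a
    centered nondegenerate [z] its only solution is [+oo]. *)
Theorem lindley_improper (z : T -> R) (M M' : T -> \bar R) :
  P.-integrable setT (EFin \o z) -> (\int[P]_w (z w)%:E = 0)%E ->
  (P [set w | (z w < 0)%R] != 0)%E ->
  measurable_fun setT M -> measurable_fun setT M' ->
  (forall w, 0 <= M' w)%E ->
  (forall w, M w = maxe 0 ((z w)%:E + M' w))%E ->
  (forall (D : set R) (C : set (\bar R)), measurable D -> measurable C ->
     P (z @^-1` D `&` M' @^-1` C) = (P (z @^-1` D) * P (M @^-1` C))%E) ->
  P [set w | (M w < +oo)%E] = 0%E.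
Proof.
move=> iz Ez zneg mM mM' M'0 Mrec indep.
have mz := integrable_measurable iz.
have M0 w : (0 <= M w)%E by rewrite Mrec le_max lexx.
have law C : measurable C -> P (M' @^-1` C) = P (M @^-1` C).
  move=> mC; have := indep setT C measurableT mC.
  by rewrite preimage_setT setTI probability_setT mul1e.
(* Since [fine +oo = 0], the real functions [N] and [N'] agree off [A]. *)
pose N w := fine (M w); pose N' w := fine (M' w).
have mN : measurable_fun setT N by exact: measurableT_comp.
have mN' : measurable_fun setT N' by exact: measurableT_comp.
have N0 w : 0 <= N w by exact: fine_ge0.
have N'0 w : 0 <= N' w by exact: fine_ge0.
pose A := [set w | (M' w < +oo)%E].
have ltyE (f : T -> \bar R) : [set w | (f w < +oo)%E] = f @^-1` [set~ +oo%E].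
  by apply/seteqP; split => w /=; rewrite ltey => /eqP.
have my : measurable [set~ +oo%E : \bar R] by exact/measurableC.
have mA : measurable A by rewrite /A ltyE; exact: measurable_preimage.
have NA w : A w -> N w = Num.max 0 (z w + N' w) /\ M w = (N w)%:E.
  move=> Aw; have M'E : M' w = (N' w)%:E by rewrite fineK// ge0_fin_numE.
  have ME : M w = (Num.max 0 (z w + N' w))%:E.
    by rewrite Mrec M'E -EFinD EFin_max.
  by rewrite /N ME.
have NnA w : ~ A w -> N w = 0 /\ N' w = 0.
  move=> /negP; rewrite /A/= -leNgt leye_eq => /eqP M'E.
  by rewrite /N /N' Mrec M'E addey// maxey.
have upper w : `|N w - N' w| <= `|z w|.
  have [Aw|nAw] := pselect (A w); last first.
    by have [-> ->] := NnA w nAw; rewrite subrr normr0.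
  have [-> _] := NA w Aw; have := N'0 w; case: (leP 0 (z w + N' w)) => ? ?.
    by rewrite addrK.
  by rewrite sub0r normrN ger0_norm// ltr0_norm; lra.
have lower w : z w * \1_A w <= N w - N' w.
  have [Aw|nAw] := pselect (A w); rewrite indicE.
    rewrite mem_set// mulr1; have [-> _] := NA w Aw.
    by rewrite lerBrDr le_max lexx orbT.
  by rewrite memNset// mulr0; have [-> ->] := NnA w nAw; rewrite subrr.
have [iD D0] : P.-integrable setT (EFin \o (fun w => N w - N' w)) /\
    (\int[P]_w (N w - N' w)%:E = 0)%E.
  apply: integral_diff_same_law iz upper => // r.
  have mC : measurable (fine @^-1` `]r, +oo[ : set (\bar R)).
    exact: (measurable_preimage (fine_measurable measurableT)).
  by rewrite !superlevelE -(law _ mC).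
have zA0 : (\int[P]_w (z w * \1_A w)%:E = 0)%E.
  rewrite integral_indep// ?Ez ?mule0// => D mD.
  by rewrite /A ltyE indep// law.
have : ae_eq P setT (fun w => (N w - N' w - z w * \1_A w)%:E) (cst 0%E).
  apply/ae_eq_integral_abs => //.
    apply/measurable_EFinP; apply: measurable_funB; first exact: measurable_funB.
    exact: integrable_measurable (integrable_mul_indic mA iz).
  transitivity (\int[P]_w ((N w - N' w)%:E - (z w * \1_A w)%:E))%E.
    by apply: eq_integral => w _; rewrite gee0_abs ?lee_fin ?subr_ge0.
  by rewrite integralB_EFin ?D0 ?zA0 ?sube0//; exact: integrable_mul_indic.
move=> [E [mE E0 subE]].
have eqE w : ~ E w -> N w - N' w = z w * \1_A w.
  move=> nE; apply: contrapT => ne; apply/nE/subE => /= /(_ I) [] /eqP.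
  by rewrite subr_eq0 => /eqP.
have [a a0 na] := negative_tail mz zneg.
have mlt (k : nat) (f : T -> \bar R) : measurable_fun setT f ->
    measurable (f @^-1` `]-oo, (k%:R * a)%:E[).
  by move=> mf; apply: measurable_preimage => //; exact: emeasurable_itv.
have step (k : nat) : P (M @^-1` `]-oo, (k%:R * a)%:E[) = 0%E.
  elim: k => [|k ih].
    rewrite (_ : _ @^-1` _ = set0) ?measure0//; apply/seteqP; split => w //=.
    by rewrite in_itv/= mul0r ltNge M0.
  have : P (z @^-1` `]-oo, -a] `&` M' @^-1` `]-oo, (k.+1%:R * a)%:E[) = 0%E.
    apply: (@subset_measure0 _ _ _ P _
              (M @^-1` `]-oo, (k%:R * a)%:E[ `|` E)).
    - by apply: measurableI; [exact: measurable_preimage|exact: mlt].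
    - by apply: measurableU => //; exact: mlt.
    - move=> w [] /=; rewrite !in_itv/= => za M'k.
      have [Ew|nEw] := pselect (E w); [by right|left].
      have Aw : A w by exact: (lt_trans M'k (ltry _)).
      have M'E : M' w = (N' w)%:E by rewrite fineK// ge0_fin_numE.
      have [_ ->] := NA w Aw; move: M'k; rewrite M'E !lte_fin.
      have := eqE w nEw; rewrite indicE mem_set// mulr1 -natr1; lra.
    - by apply: null_set_setU => //; exact: mlt.
  rewrite indep//; last exact: emeasurable_itv.
  by move/eqP; rewrite mule_eq0 (negbTE na) => /eqP.
apply/negligibleP; first by rewrite ltyE; exact: measurable_preimage.
have -> : [set w | (M w < +oo)%E] = \bigcup_k (M @^-1` `]-oo, (k%:R * a)%:E[).
  apply/seteqP; split => w /=.
    move=> My; have ME : M w = (N w)%:E by rewrite fineK// ge0_fin_numE.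
    exists (Num.truncn (N w / a)).+1 => //=; rewrite in_itv/= ME lte_fin.
    by rewrite -ltr_pdivrMr// truncnS_gt.
  by move=> [k _ /=]; rewrite in_itv/= => /lt_trans; apply; rewrite ltry.
by apply: negligible_bigcup => k; apply/negligibleP; [exact: mlt|exact: step].
Qed.

End lindley.

(** * Product laws on sequence spaces *)

Section product_rule.
Context (d d' : measure_display) (T : measurableType d) (E : measurableType d').
Context (R : realType).
Variables (P : probability T R) (G : set (set E)).
Hypotheses (GE : measurable = <<s G >>) (GI : setI_closed G) (GT : G setT).

(** Both sides are finite measures in [C], so they agree once they agree on a
    generating pi-system.  Having two maps [f] and [g] lets the same statement
    express independence from [B] ([f = g]), equality of laws ([B = setT]), or
    both at once. *)
Lemma product_rule_dynkin (B : set T) (f g : T -> E) :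
  measurable B -> measurable_fun setT f -> measurable_fun setT g ->
  (forall C, G C -> P (B `&` f @^-1` C) = (P B * P (g @^-1` C))%E) ->
  forall C, measurable C -> P (B `&` f @^-1` C) = (P B * P (g @^-1` C))%E.
Proof.
move=> mB mf mg BG C mC.
have pB : 0 <= fine (P B) by exact: fine_ge0.
pose H : {mfun T >-> E} := HB.pack g (isMeasurableFun.Build _ _ _ _ _ mg).
(* The measure instance on a pushforward depends on the measurability of the
   map, over which [restr] is abstracted. *)
pose restr : {measure set E -> \bar R} := pushforward (mrestr P mB) f.
pose m1 := restr mf.
pose m2 : {measure set E -> \bar R} := mscale (NngNum pB) (distribution P H).
have m1E A : m1 A = P (B `&` f @^-1` A).
  by rewrite /m1 /= /pushforward /mrestr/= setIC.
have m2E A : m2 A = (P B * P (g @^-1` A))%E.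
  by rewrite /m2/= /mscale /= fineK ?fin_num_measure.
rewrite -m1E -m2E; apply: (measure_unique G (fun=> setT)) => //.
- by rewrite bigcup_const//; exists 0%N.
- by move=> A /BG; rewrite m1E m2E.
- by move=> _; rewrite m1E preimage_setT setIT ltey_eq fin_num_measure.
Qed.

End product_rule.

Section sequence_space.
Context (d' : measure_display) (S : measurableType d').
Variable G : set (set S).
Hypotheses (GS : measurable = <<s G >>) (GI : setI_closed G) (GT : G setT).

Definition cylinders : set (set (nat -> S)) :=
  [set C | exists n (A : nat -> set S), (forall i, G (A i)) /\
    C = [set f | forall i, (i < n)%N -> A i (f i)]].

Definition sequences : Type := g_sigma_algebraType cylinders.
HB.instance Definition _ := Measurable.on sequences.

Lemma cylinders_setI : setI_closed cylinders.
Proof.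
move=> _ _ [n [A [GA ->]]] [m [B [GB ->]]].
exists (maxn n m), (fun i => (if (i < n)%N then A i else setT) `&`
                             (if (i < m)%N then B i else setT)); split.
  by move=> i; apply: GI; case: ifP.
apply/seteqP; split => f /=.
  by move=> [fA fB] i _; split; case: ifP => // ?; [exact: fA|exact: fB].
move=> fAB; split => i im; have := fAB i.
  by rewrite leq_max im => /(_ isT)[].
by rewrite leq_max im orbT => /(_ isT)[].
Qed.

Lemma cylindersT : cylinders setT.
Proof. by exists 0%N, (fun=> setT); split => //; apply/seteqP; split. Qed.

Lemma measurable_coordinate k : measurable_fun setT (fun f : sequences => f k).
Proof.
apply: (measurability _ GS) => _ [A GA <-]; rewrite setTI.
apply: sub_sigma_algebra.
exists k.+1, (fun i => if i == k then A else setT); split.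
  by move=> i; case: ifP.
apply/seteqP; split => f /= fA.
  by move=> i _; case: eqP => // ->.
by have := fA k (ltnSn k); rewrite eqxx.
Qed.

Lemma measurable_sequence d (T : measurableType d) (U : nat -> T -> S) :
  (forall k, measurable_fun setT (U k)) ->
  measurable_fun setT (fun w => (fun k => U k w) : sequences).
Proof.
move=> mU; apply: (@measurability _ _ T sequences setT _ cylinders erefl).
move=> _ [_ [n [A [GA ->]]] <-]; rewrite setTI.
set B := (X in measurable X).
have -> : B = \bigcap_(i in [set i | (i < n)%N]) (U i @^-1` A i).
  by apply/seteqP; split => w /= h i; apply: h.
apply: bigcap_measurableType => i _; apply: measurable_preimage => //.
by rewrite GS; exact: sub_sigma_algebra.
Qed.

End sequence_space.

Section iid.
Context (d d' : measure_display) (T : measurableType d) (S : measurableType d').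
Context (R : realType).
Variables (P : probability T R) (G : set (set S)).
Hypotheses (GS : measurable = <<s G >>) (GI : setI_closed G) (GT : G setT).
Variable V : nat -> T -> S.
Hypothesis mV : forall k, measurable_fun setT (V k).
Hypothesis iidV : forall n (A : nat -> set S), (forall i, G (A i)) ->
  P [set w | forall i, (i < n)%N -> A i (V i w)] =
  (\prod_(i < n) P (V 0 @^-1` A i))%E.

(** The first term is independent of the shifted sequence, and the shifted
    sequence has the law of the original one: on cylinders this is the
    splitting of one factor off a finite product, and two uses of Dynkin's
    argument extend it, first in [C] and then in [D]. *)
Lemma iid_shift (D : set S) (C : set (sequences G)) :
  measurable D -> measurable C ->
  P (V 0%N @^-1` D `&` (fun w k => V k.+1 w) @^-1` C) =
  (P (V 0%N @^-1` D) * P ((fun w k => V k w) @^-1` C))%E.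
Proof.
have mY : measurable_fun setT (fun w => (fun k => V k w) : sequences G).
  exact: measurable_sequence.
have mY' : measurable_fun setT (fun w => (fun k => V k.+1 w) : sequences G).
  exact: measurable_sequence.
have mG A : G A -> measurable A by rewrite GS; exact: sub_sigma_algebra.
have GC D' : G D' -> forall C' : set (sequences G), measurable C' ->
    P (V 0%N @^-1` D' `&` (fun w k => V k.+1 w) @^-1` C') =
    (P (V 0%N @^-1` D') * P ((fun w k => V k w) @^-1` C'))%E.
  move=> GD' C' mC'.
  apply: (@product_rule_dynkin _ _ _ (sequences G) R P (cylinders G)) => //.
  - exact: cylinders_setI.
  - exact: cylindersT.
  - by apply: measurable_preimage => //; exact: mG.
  move=> _ [n [A [GA ->]]].
  pose A' i := if i is j.+1 then A j else D'.
  set L := (X in P X = _).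
  have -> : L = [set w | forall i, (i < n.+1)%N -> A' i (V i w)].
    apply/seteqP; split => w /=; first by move=> [? h] [|i]//; exact: h.
    by move=> h; split; [exact: (h 0%N)|move=> i; exact: (h i.+1)].
  by rewrite (@iidV n.+1 A') ?iidV ?big_ord_recl//; case.
move=> mD mC.
have mC' : measurable ((fun w k => V k.+1 w) @^-1` C).
  exact: measurable_preimage mY' mC.
have PC : P ((fun w k => V k.+1 w) @^-1` C) = P ((fun w k => V k w) @^-1` C).
  have := GC setT GT C mC.
  by rewrite preimage_setT setTI probability_setT mul1e.
rewrite setIC muleC -PC.
apply: (@product_rule_dynkin _ _ _ S R P G) => // D' GD'.
by rewrite setIC GC// PC muleC.
Qed.

End iid.

(** * Centered random walks *)

Definition sup_partial_sums (R : realType) (x : nat -> R) : \bar R :=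
  ereal_sup [set (\sum_(k < n) x k)%:E | n in setT].

(** The empty sum contributes the [0]; every other partial sum is [x 0] plus a
    partial sum of the shifted sequence. *)
Lemma sup_partial_sums_shift (R : realType) (x : nat -> R) :
  sup_partial_sums x =
  (maxe 0%E ((x 0%N)%:E + sup_partial_sums (fun k => x k.+1)))%E.
Proof.
apply/le_anti/andP; split.
  apply: ge_ereal_sup => _ [[|n] _ <-]; first by rewrite big_ord0 le_max lexx.
  rewrite big_ord_recl EFinD le_max; apply/orP; right.
  by apply: leeD => //; apply: ereal_sup_ubound; exists n.
rewrite ge_max; apply/andP; split.
  by apply: ereal_sup_ubound; exists 0%N => //; rewrite big_ord0.
rewrite -leeBrDl//; apply: ge_ereal_sup => _ [n _ <-]; rewrite leeBrDl//.
by apply: ereal_sup_ubound; exists n.+1 => //; rewrite big_ord_recl.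
Qed.

Section random_walk.
Context (d d' : measure_display) (T : measurableType d) (S : measurableType d').
Context (R : realType).
Variables (P : probability T R) (G : set (set S)).
Hypotheses (GS : measurable = <<s G >>) (GI : setI_closed G) (GT : G setT).
Variable V : nat -> T -> S.
Hypothesis mV : forall k, measurable_fun setT (V k).
Hypothesis iidV : forall n (A : nat -> set S), (forall i, G (A i)) ->
  P [set w | forall i, (i < n)%N -> A i (V i w)] =
  (\prod_(i < n) P (V 0 @^-1` A i))%E.

(** The increments are functions [zeta (V k)] of an independent sequence in an
    arbitrary space, so that independence only has to be checked on a
    pi-system generating that space, not on events about the increments. *)
Lemma centered_walk_unbounded (zeta : S -> R) :
  measurable_fun setT zeta ->
  P.-integrable setT (EFin \o (zeta \o V 0%N)) ->
  (\int[P]_w (zeta (V 0%N w))%:E = 0)%E ->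
  (P [set w | (zeta (V 0%N w) < 0)%R] != 0)%E ->
  forall u : R, P [set w | exists n, u < \sum_(k < n) zeta (V k w)] = 1%E.
Proof.
move=> mzeta iz Ez zneg u.
pose sums n (f : sequences G) := \sum_(k < n) zeta (f k).
have msums n : measurable_fun setT (sums n).
  apply: measurable_sum => k; apply: measurableT_comp => //.
  exact: (measurable_coordinate GS).
pose M (f : sequences G) := sup_partial_sums (zeta \o f).
have mM : measurable_fun setT M.
  have -> : M = fun f => esups (fun n => (sums n f)%:E) 0%N.
    apply/funext => f; rewrite /M /sup_partial_sums /esups /=; congr ereal_sup.
    by apply/seteqP; split => _ [n _ <-]; exists n.
  by apply: measurable_fun_esups => n; exact/measurable_EFinP.
have mMU (U : nat -> T -> S) : (forall k, measurable_fun setT (U k)) ->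
    measurable_fun setT (fun w => M (fun k => U k w)).
  by move=> mU; exact: (measurableT_comp mM (measurable_sequence GS mU)).
have M0 f : (0 <= M f)%E by rewrite /M sup_partial_sums_shift le_max lexx.
have finite0 : P [set w | (M (fun k => V k w) < +oo)%E] = 0%E.
  apply: (lindley_improper iz Ez zneg (mMU V mV)
    (mMU (fun k => V k.+1) (fun k => mV k.+1)) (fun w => M0 _)
    (fun w => sup_partial_sums_shift _)) => D C mD mC.
  exact: (iid_shift GS GI GT mV iidV (measurable_preimage mzeta mD)
            (measurable_preimage mM mC)).
set U := (X in P X).
have mU : measurable U.
  have -> : U = \bigcup_n [set w | u < \sum_(k < n) zeta (V k w)].
    by apply/seteqP; split => w /=; [case=> n|case=> n _]; exists n.
  apply: bigcupT_measurable => n; rewrite superlevelE.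
  apply: measurable_preimage => //.
  by apply: measurable_sum => k; exact: measurableT_comp.
have CU : P (~` U) = 0%E.
  apply: (subset_measure0 _ _ _ finite0); first exact: measurableC.
    have := measurable_preimage (mMU V mV) (measurableC (emeasurable_set1 +oo)).
    congr measurable.
    by apply/seteqP; split => w /=; rewrite ltey => /eqP.
  move=> w /= nU; apply: (@le_lt_trans _ _ u%:E); last exact: ltry.
  apply: ge_ereal_sup => _ [n _ <-]; rewrite lee_fin leNgt; apply/negP => un.
  by apply: nU; exists n.
by rewrite -(setCK U) probability_setC ?CU ?sube0//; exact: measurableC.
Qed.

End random_walk.

(** * Ruin as an event of the random walk *)

(** The monotonicity makes [s] hold on an initial segment; without it, the
    number of positive integers in [s] would not tell which ones they are. *)
Lemma counting_initial_segment (R : realType) (s : nat -> bool) (k : nat) :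
  {homo s : m n / (m <= n)%N >-> n ==> m} ->
  ((k.+1)%:R%:E <= counting [set n | (1 <= n)%N /\ s n] :> \bar R)%E = s k.+1.
Proof.
move=> hs; set J := [set n | _].
have II m : `I_m.+1 `\` `I_1 #= `I_m by have := @card_IID m.+1 1; rewrite subn1.
rewrite /counting; case: asboolP => fJ; last first.
  rewrite leey; apply/esym; apply: contra_notT fJ => nsk.
  apply: (@sub_finite_set _ _ `I_k.+1) => // n [_ sn] /=; rewrite ltnNge.
  by apply: contra nsk => /hs; rewrite sn.
have /finite_setP[m Jm] := fJ.
rewrite lee_fin ler_nat (card_fset_set Jm) -card_le_II -(card_le_eqr Jm).
apply/idP/idP => [kJ|sk].
  apply: contraT => nsk.
  have : `I_k.+1 #<= `I_k.
    rewrite -(card_le_eqr (II k)).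
    apply: (card_le_trans kJ); apply: subset_card_le.
    move=> n [n1 sn] /=; split; last by apply/negP; rewrite -leqNgt.
    by rewrite ltnS leqNgt; apply: contra nsk => /hs; rewrite sn.
  by rewrite card_le_II ltnn.
rewrite -(card_le_eql (II k.+1)); apply: subset_card_le => n [/=].
rewrite ltnS => nk n0; split; last by move/hs : nk; rewrite sk.
by rewrite lt0n; apply/eqP => n0'; apply: n0; rewrite n0'.
Qed.

Section ruin.
Context (d : measure_display) (T : measurableType d) (R : realType).
Variables (P : probability T R) (c u : R) (X_ theta_ : nat -> {RV P >-> R}).
Hypothesis c0 : 0 < c.
Hypothesis X0 : forall n w, 0 <= X_ n w.
Hypothesis theta0 : forall n w, 0 <= theta_ n w.

Let arrival n w := \sum_(k < n) theta_ k w.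

Let arrival0 n w : 0 <= arrival n w.
Proof. exact: sumr_ge0. Qed.

Let arrival_homo w m n : (m <= n)%N -> arrival m w <= arrival n w.
Proof.
move=> mn; rewrite /arrival -!(big_mkord xpredT (fun k => theta_ k w)).
by rewrite (big_cat_nat _ mn)//= lerDl sumr_ge0.
Qed.

Lemma claim_counted k t w :
  ((k.+1)%:R%:E <= claim_count theta_ t w)%E = (arrival k.+1 w <= t)%R.
Proof.
rewrite /claim_count.
rewrite -(@counting_initial_segment R (fun n => arrival n w <= t)).
  congr (_ <= counting _)%E; apply/seteqP; split => n /= [n1].
    by move=> /andP[].
  by move=> nt; split; rewrite // arrival0.
by move=> m n mn; apply/implyP; apply: le_trans; exact: arrival_homo.
Qed.

Lemma surplus_lt0 t w :
  (surplus c u X_ theta_ t w < 0)%E =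
  ((u + c * t)%:E <
   \sum_(0 <= k <oo | (arrival k.+1 w <= t)%R) (X_ k w)%:E)%E.
Proof.
rewrite /surplus sube_lt0//; congr (_ < _)%E.
apply: congr_lim; apply/funext => n.
by apply: eq_bigl => k; rewrite claim_counted.
Qed.

(** Between claims the surplus increases, so ruin can only occur at a claim.
    This is an equality of sets, with no exceptional outcomes: if infinitely
    many claims arrive by time [t], then ruin by time [t] is still witnessed by
    finitely many of them. *)
Lemma ruin_walkE :
  [set w | (ruin_time c u X_ theta_ w < +oo)%E] =
  [set w | exists n, u < \sum_(k < n) (X_ k w - c * theta_ k w)].
Proof.
have walk n w : \sum_(k < n) (X_ k w - c * theta_ k w) =
    \sum_(k < n) X_ k w - c * arrival n w.
  by rewrite big_split/= sumrN -mulr_sumr.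
apply/seteqP; split => w /=.
  move=> /ereal_inf_lt[_ [t [t0 +] <-] _]; rewrite surplus_lt0 => ruin.
  apply: contrapT => nruin; move: ruin; apply/negP; rewrite -leNgt.
  have le n : \sum_(k < n) X_ k w <= u + c * arrival n w.
    rewrite leNgt; apply/negP => h; apply: nruin; exists n.
    by rewrite walk ltrBrDr.
  apply: lime_le; first by apply: is_cvg_nneseries => n _ _; rewrite lee_fin.
  apply: nearW => n; elim: n => [|n ih].
    have := le 0%N; rewrite /arrival !big_ord0 mulr0 addr0 => u0.
    by rewrite big_geq// lee_fin addr_ge0// mulr_ge0// ltW.
  have [nt|tn] := leP (arrival n.+1 w) t.
    (* All of the first [n.+1] claims have arrived by time [t]. *)
    rewrite big_mkord (eq_bigl xpredT) => [|k]; last first.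
      by rewrite (le_trans _ nt)// arrival_homo.
    by rewrite sumEFin lee_fin (le_trans (le n.+1))// lerD2l ler_pM2l.
  rewrite big_mkcond big_nat_recr//= (leNgt (arrival _ _)) tn adde0.
  by rewrite -big_mkcond.
move=> [n]; rewrite walk ltrBrDr => un.
apply: (@le_lt_trans _ _ (arrival n w)%:E); last exact: ltry.
apply: ereal_inf_lbound; exists (arrival n w) => //; split => //.
rewrite surplus_lt0; apply: (@lt_le_trans _ _ (\sum_(k < n) X_ k w)%:E).
  by rewrite lte_fin.
apply: le_trans (nneseries_lim_ge n _); last by move=> k _ _; rewrite lee_fin.
rewrite big_mkord [leRHS](eq_bigl xpredT) => [|k]; last first.
  exact: (arrival_homo w (ltn_ord k)).
by rewrite sumEFin.
Qed.

End ruin.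

(** * Independence of the pairs of claims and waiting times *)

Section claims.
Context (d : measure_display) (T : measurableType d) (R : realType).
Variable P : probability T R.

Lemma sigma_of_preimage (Y : {RV P >-> R}) (A : set R) :
  measurable A -> sigma_of Y (Y @^-1` A).
Proof. by move=> mA; exists A => //; rewrite setTI. Qed.

Lemma sigma_of_seq_finite (Y_ : nat -> {RV P >-> R}) (A : nat -> set R) n :
  (forall i, measurable (A i)) ->
  sigma_of_seq Y_ [set w | forall i, (i < n)%N -> A i (Y_ i w)].
Proof.
move=> mA; pose F := \bigcup_n sigma_of (Y_ n).
have -> : [set w | forall i, (i < n)%N -> A i (Y_ i w)] =
    \bigcap_(i in [set i | (i < n)%N]) (Y_ i @^-1` A i).
  by apply/seteqP; split => w /= h i; apply: h.
have : measurable (\bigcap_(i in [set i | (i < n)%N]) (Y_ i @^-1` A i)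
  : set (g_sigma_algebraType F)); last by [].
apply: bigcap_measurableType => i _; apply: sub_sigma_algebra.
by exists i => //; exact: sigma_of_preimage.
Qed.

Lemma iid_rectangle (Y_ : nat -> {RV P >-> R}) (Y : {RV P >-> R})
    (A : nat -> set R) n :
  independent_copies Y_ Y -> (forall i, measurable (A i)) ->
  P [set w | forall i, (i < n)%N -> A i (Y_ i w)] =
  (\prod_(i < n) P (Y_ 0%N @^-1` A i))%E.
Proof.
move=> [indep law] mA.
have -> : [set w | forall i, (i < n)%N -> A i (Y_ i w)] =
    \bigcap_(i in [set` iota 0 n]) (Y_ i @^-1` A i).
  by apply/seteqP; split => w /= h i; have := h i; rewrite /= mem_iota.
rewrite (indep _ _ (iota_uniq 0 n)) => [|i _]; last exact: sigma_of_preimage.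
rewrite -[n in LHS]subn0 -/(index_iota 0 n) big_mkord; apply: eq_bigr => i _.
by have := law i _ (mA i); rewrite -(law 0%N _ (mA i)).
Qed.

Lemma integral_same_distribution (X Y : {RV P >-> R}) :
  (forall w, 0 <= X w) -> (forall w, 0 <= Y w) -> same_distribution X Y ->
  (\int[P]_w (X w)%:E = \int[P]_w (Y w)%:E)%E.
Proof.
move=> X0 Y0 XY.
rewrite (@ge0_integral_tail_scale _ _ _ P X Y 1%E)// ?mul1e// => r _.
by rewrite mul1e !superlevelE; exact: XY.
Qed.

Definition boxes : set (set (R * R)) :=
  [set A `*` B | A in measurable & B in measurable].

Lemma boxes_setI : setI_closed boxes.
Proof.
move=> _ _ [A1 mA1 [A2 mA2 <-]] [B1 mB1 [B2 mB2 <-]].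
exists (A1 `&` B1); first exact: measurableI.
by exists (A2 `&` B2); [exact: measurableI|rewrite setXI].
Qed.

Lemma boxesT : boxes setT.
Proof. by exists setT => //; exists setT => //; rewrite setXTT. Qed.

Lemma iid_pairs (X theta : {RV P >-> R}) (X_ theta_ : nat -> {RV P >-> R}) :
  independent_copies X_ X -> independent_copies theta_ theta ->
  independent_systems P (sigma_of_seq X_) (sigma_of_seq theta_) ->
  forall n (A : nat -> set (R * R)), (forall i, boxes (A i)) ->
  P [set w | forall i, (i < n)%N -> A i (X_ i w, theta_ i w)] =
  (\prod_(i < n) P ((fun w => (X_ 0%N w, theta_ 0%N w)) @^-1` A i))%E.
Proof.
move=> iidX iidtheta indep n A bA.
have /choice[B /all_and3[mA1 mA2 A12]] i : exists B : set R * set R,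
    [/\ measurable B.1, measurable B.2 & B.1 `*` B.2 = A i].
  by have [B1 mB1 [B2 mB2 <-]] := bA i; exists (B1, B2).
pose A1 i := (B i).1; pose A2 i := (B i).2.
have box m (B1 B2 : nat -> set R) : (forall i, measurable (B1 i)) ->
    (forall i, measurable (B2 i)) ->
    P [set w | forall i, (i < m)%N -> (B1 i `*` B2 i) (X_ i w, theta_ i w)] =
    (\prod_(i < m) P (X_ 0%N @^-1` B1 i) *
     \prod_(i < m) P (theta_ 0%N @^-1` B2 i))%E.
  move=> mB1 mB2.
  rewrite -(iid_rectangle m iidX mB1) -(iid_rectangle m iidtheta mB2).
  rewrite -indep; [|exact: sigma_of_seq_finite|exact: sigma_of_seq_finite].
  congr (P _); apply/seteqP; split => w /=.
    by move=> h; split => i /h[].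
  by move=> [h1 h2] i im; split; [exact: h1|exact: h2].
have -> : [set w | forall i, (i < n)%N -> A i (X_ i w, theta_ i w)] =
    [set w | forall i, (i < n)%N -> (A1 i `*` A2 i) (X_ i w, theta_ i w)].
  by apply/seteqP; split => w /= h i /h; rewrite -A12.
rewrite box// -big_split/=; apply: eq_bigr => i _.
(* The case of a single pair identifies each factor. *)
have := box 1%N (fun=> A1 i) (fun=> A2 i) (fun=> mA1 i) (fun=> mA2 i).
rewrite !big_ord1 => <-; congr (P _); apply/seteqP; split => w /=; rewrite -A12.
  by move=> /(_ 0%N isT).
by move=> h [].
Qed.

End claims.

(** * Certain ruin at zero safety loading *)

Theorem theorem3 (R : realType) (d : measure_display) (T : measurableType d)
  (P : probability T R) (c : R)
  (X theta : {RV P >-> R}) (X_ theta_ : nat -> {RV P >-> R})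
  (hc : 0 < c)
  (X_ge0 : forall w, 0 <= X w) (theta_ge0 : forall w, 0 <= theta w)
  (Xn_ge0 : forall n w, 0 <= X_ n w)
  (thetan_ge0 : forall n w, 0 <= theta_ n w)
  (theta_nonzero : (P [set w | theta w = 0%R] < 1)%E)
  (X_copies : independent_copies X_ X)
  (theta_copies : independent_copies theta_ theta)
  (X_theta_indep : independent_systems P (sigma_of X) (sigma_of theta))
  (seq_indep :
    independent_systems P (sigma_of_seq X_) (sigma_of_seq theta_))
  (EX_fin : ('E_P[X] < +oo)%E) (Etheta_fin : ('E_P[theta] < +oo)%E)
  (ratio_eq_c : fine 'E_P[X] / fine 'E_P[theta] = c)
  (nondegenerate : (P [set w | X w = (c * theta w)%R] < 1)%E) :
  forall u : R, 0 <= u -> ruin_probability c u X_ theta_ = 1%E.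
Proof.
move=> u _; rewrite /ruin_probability ruin_walkE//.
pose zeta (p : R * R) := p.1 - c * p.2.
pose V n w := (X_ n w, theta_ n w).
have mzeta : measurable_fun setT zeta.
  by apply: measurable_funB => //; exact: measurable_funM.
have mV n : measurable_fun setT (V n) by exact: measurable_fun_pair.
have boxesE : measurable = <<s @boxes R >>.
  exact: measurable_prod_measurableType.
have integ (Y : {RV P >-> R}) (Y_ : nat -> {RV P >-> R}) :
    (forall w, 0 <= Y w) -> (forall n w, 0 <= Y_ n w) ->
    independent_copies Y_ Y -> ('E_P[Y] < +oo)%E ->
    P.-integrable setT (EFin \o Y_ 0%N) /\
    (\int[P]_w (Y_ 0%N w)%:E = (fine 'E_P[Y])%:E)%E.
  move=> Y0 Yn0 [_ law] EY.
  have E0 : (\int[P]_w (Y_ 0%N w)%:E = 'E_P[Y])%E.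
    by rewrite unlock; apply: integral_same_distribution => //; exact: law.
  split; last by rewrite E0 fineK// ge0_fin_numE// expectation_ge0.
  apply/integrableP; split; first exact/measurable_EFinP.
  under eq_integral do rewrite /= ger0_norm//.
  by rewrite E0.
have [iX EX] := integ _ _ X_ge0 Xn_ge0 X_copies EX_fin.
have [itheta Etheta] := integ _ _ theta_ge0 thetan_ge0 theta_copies Etheta_fin.
have ictheta : P.-integrable setT (EFin \o (fun w => c * theta_ 0%N w)).
  exact: (integrableZl measurableT c itheta).
have iz : P.-integrable setT (EFin \o (zeta \o V 0%N)).
  exact: (integrableB measurableT iX ictheta).
have m0 : fine 'E_P[theta] != 0.
  apply/eqP => m0; move: ratio_eq_c hc.
  by rewrite m0 invr0 mulr0 => <-; rewrite ltxx.
have Ez : (\int[P]_w (zeta (V 0%N w))%:E = 0)%E.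
  transitivity (\int[P]_w ((X_ 0%N w)%:E - (c * theta_ 0%N w)%R%:E))%E.
    by apply: eq_integral => w _; rewrite -EFinB.
  rewrite integralB_EFin// EX.
  under [X in (_ - X)%E]eq_integral do rewrite EFinM.
  by rewrite integralZl// Etheta -EFinM -EFinB -ratio_eq_c divfK// subrr.
apply: (centered_walk_unbounded boxesE (@boxes_setI R) (@boxesT R) mV _
          mzeta iz Ez).
  exact: (iid_pairs X_copies theta_copies seq_indep).
apply: centered_negative => //.
(* Nondegeneracy is assumed for [(X, theta)], whose law is that of the first
   pair because both are product laws with the same marginals. *)
pose diagonal := [set p : R * R | zeta p = 0].
have mdiag : measurable diagonal.
  exact: (measurable_preimage mzeta (measurable_set1 0)).
have lawV : P ((fun w => (X w, theta w)) @^-1` diagonal) =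
    P (V 0%N @^-1` diagonal).
  have := @product_rule_dynkin _ _ T (R * R)%type R P (@boxes R) boxesE
    (@boxes_setI R) (@boxesT R) setT (fun w => (X w, theta w)) (V 0%N).
  rewrite probability_setT => /(_ measurableT) H.
  have := H _ (mV 0%N) _ diagonal mdiag; rewrite setTI mul1e; apply.
    exact: measurable_fun_pair.
  move=> _ [A mA [B mB <-]]; rewrite setTI mul1e.
  have -> : (fun w => (X w, theta w)) @^-1` (A `*` B) =
      X @^-1` A `&` theta @^-1` B by [].
  rewrite X_theta_indep; [|exact: sigma_of_preimage|exact: sigma_of_preimage].
  have := X_copies.2 0%N A mA; have := theta_copies.2 0%N B mB.
  rewrite /distribution /pushforward => <- <-.
  rewrite -seq_indep//; apply: sub_sigma_algebra; exists 0%N => //;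
    exact: sigma_of_preimage.
have -> : [set w | (zeta \o V 0%N) w = 0] = V 0%N @^-1` diagonal by [].
rewrite -lawV; move: nondegenerate; congr (P _ < _)%E.
apply/seteqP; split => w /= /eqP; first by rewrite -subr_eq0 => /eqP.
by rewrite subr_eq0 => /eqP.
Qed.
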